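(* There exists a universal constant $\epsilon_0>0$ such that the following holds for every finite graph $\mathcal{G}$. Let $B\in\mathbb{S}^{m+n}$, and the integers $n,m$, be constructed from $\mathcal{G}$ by the $(P_2)$ input construction. Then: (i) If $\mathcal{G}$ is 3-colorable, there exists $\mathbf{d}\in\mathbb{R}_+^{n+m}$ such that $B+\operatorname{Diag}(\mathbf{d})\succeq 0$ and $\operatorname{rank}(B+\operatorname{Diag}(\mathbf{d}))\le m+3$. (ii) Conversely, if there exist $\mathbf{d}\in\mathbb{R}_+^{n+m}$ and $H\in\mathbb{S}^{n+m}$ such that $\|H\|_F\le\epsilon_0$, $B+\operatorname{Diag}(\mathbf{d})+H\succeq 0$, $\operatorname{rank}(B+\operatorname{Diag}(\mathbf{d})+H)\le m+3$, and $\mathrm{nz}(H)\subseteq\mathrm{nz}(B)$, then $\mathcal{G}$ is 3-colorable.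
   Context: All graphs are finite, undirected, simple and loopless; $\mathcal{V}(\cdot)$, $\mathcal{E}(\cdot)$ denote vertex and edge sets. $\mathbb{S}^N$ is the space of real symmetric $N\times N$ matrices, $\succeq0$ means positive semidefinite, $\|\cdot\|_F$ is the Frobenius norm, $\mathbb{R}_+^N$ is the nonnegative orthant, $\operatorname{Diag}(\mathbf{d})$ is the diagonal matrix with diagonal $\mathbf{d}$, and $\mathrm{nz}(M)$ is the set of positions of the nonzero entries of $M$. Peeters supergraph: $\mathcal{G}'$ is obtained from $\mathcal{G}$ by adding, for each unordered pair of distinct vertices $i,j\in\mathcal{V}(\mathcal{G})$ (adjacent or not, listed in some fixed order $i,j$), four new vertices $a_{ij},b_{ij},c_{ij},d_{ij}$ and the nine edges $\{i,a_{ij}\},\{i,b_{ij}\},\{a_{ij},b_{ij}\},\{j,c_{ij}\},\{j,d_{ij}\},\{c_{ij},d_{ij}\},\{a_{ij},j\},\{i,d_{ij}\},\{b_{ij},c_{ij}\}$. $(P_2)$ input construction: let $n:=3|\mathcal{V}(\mathcal{G}')|$; every vertex $i$ of $\mathcal{G}'$ corresponds to three indices $i^{(1)},i^{(2)},i^{(3)}$ with parent $\pi(i^{(\mu)})=i$. A nonedge of $\mathcal{G}'$ is a pair of distinct nonadjacent vertices. Define $A\in\mathbb{S}^n$ by $A(u,v)=2$ if $\{\pi(u),\pi(v)\}$ is a nonedge of $\mathcal{G}'$; $A(u,v)=0$ if $\{\pi(u),\pi(v)\}\in\mathcal{E}(\mathcal{G}')$; $A(u,v)=1$ if $\pi(u)=\pi(v)$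 and $u\ne v$; $A(u,u)=0$. Let $\mathcal{G}''$ be the graph on the $n$ indices whose edges are the pairs $\{u,v\}$ such that $\{\pi(u),\pi(v)\}$ is a nonedge of $\mathcal{G}'$, and let $m:=|\mathcal{E}(\mathcal{G}'')|$. Let $K\in\{0,1\}^{n\times m}$ be the node-edge incidence matrix of $\mathcal{G}''$ (the column of edge $\{u,v\}$ has ones exactly in rows $u$ and $v$). Finally $$B:=\begin{bmatrix} 0 & K^{\top} \\ K & A \end{bmatrix}\in\mathbb{S}^{m+n}.$$ *)

(* Defs.v *)
From HB Require Import structures.
From mathcomp Require Import all_boot all_order all_algebra.
From mathcomp Require Import reals.

Set Implicit Arguments.
Unset Strict Implicit.
Unset Printing Implicit Defensive.

Import Order.TTheory GRing.Theory Num.Theory.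
Local Open Scope ring_scope.

(* A finite simple graph is a symmetric irreflexive [e : rel T] on a finType. *)

Definition nonedge (V : finType) (adj : rel V) : rel V :=
  fun x y => (x != y) && ~~ adj x y.

Definition three_colorable (V : finType) (adj : rel V) : Prop :=
  exists c : V -> 'I_3, forall x y, adj x y -> c x != c y.

(* [o i j] means that the unordered pair {i, j} is listed in the order i, j;
   nothing but "each pair is listed in exactly one order" is required, in
   particular [o] need not be transitive. *)
Definition pair_listing (T : finType) (o : rel T) : Prop :=
  irreflexive o /\ forall i j, i != j -> o i j = ~~ o j i.

Variant gadget_label := La | Lb | Lc | Ld.

Definition bools_of_label (l : gadget_label) : bool * bool :=
  match l with
  | La => (false, false) | Lb => (false, true)
  | Lc => (true, false)  | Ld => (true, true)
  end.

Definition label_of_bools (b : bool * bool) : gadget_label :=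
  match b with
  | (false, false) => La | (false, true) => Lb
  | (true, false) => Lc  | (true, true) => Ld
  end.

Lemma bools_of_labelK : cancel bools_of_label label_of_bools.
Proof. by case. Qed.

HB.instance Definition _ := Finite.copy gadget_label (can_type bools_of_labelK).

Section PeetersSupergraph.
Variables (T : finType) (e o : rel T).

Definition listed_pair : finType := {p : T * T | o p.1 p.2}.

Definition pvertex : finType := (T + listed_pair * gadget_label)%type.

Definition gadget_edges (p : listed_pair) : seq (pvertex * pvertex) :=
  let i : pvertex := inl (val p).1 in
  let j : pvertex := inl (val p).2 in
  let a : pvertex := inr (p, La) in
  let b : pvertex := inr (p, Lb) in
  let c : pvertex := inr (p, Lc) in
  let d : pvertex := inr (p, Ld) in
  [:: (i, a); (i, b); (a, b); (j, c); (j, d); (c, d); (a, j); (i, d); (b, c)].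

Definition padj : rel pvertex := fun x y =>
  (if (x, y) is (inl i, inl j) then e i j else false)
  || [exists p : listed_pair,
        ((x, y) \in gadget_edges p) || ((y, x) \in gadget_edges p)].

End PeetersSupergraph.

Arguments padj {T} e o.

Section P2Input.
(* [adj] plays the role of the supergraph, here an arbitrary graph. *)
Variables (V : finType) (adj : rel V).

Definition p2_n : nat := #|{: V * 'I_3}|.

Lemma p2_nE : p2_n = (3 * #|V|)%N.
Proof. by rewrite /p2_n card_prod card_ord mulnC. Qed.

Definition parent (u : 'I_p2_n) : V := (enum_val u).1.

Definition p2_edges : {set {set 'I_p2_n}} :=
  [set [set uv.1; uv.2] |
     uv : 'I_p2_n * 'I_p2_n & nonedge adj (parent uv.1) (parent uv.2)].

Definition p2_m : nat := #|p2_edges|.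

Variable R : realType.

Definition p2_A : 'M[R]_p2_n := \matrix_(u, v)
  if nonedge adj (parent u) (parent v) then 2
  else if adj (parent u) (parent v) then 0
  else if u != v then 1 else 0.

Definition p2_K : 'M[R]_(p2_n, p2_m) := \matrix_(u, f)
  (u \in (enum_val f : {set 'I_p2_n}))%:R.

Definition p2_B : 'M[R]_(p2_m + p2_n) := block_mx 0 p2_K^T p2_K p2_A.

End P2Input.

Arguments p2_A {V} adj R.
Arguments p2_K {V} adj R.
Arguments p2_B {V} adj R.

Section RealMatrices.
Variables (R : realType) (N : nat).
Implicit Types (M : 'M[R]_N) (d : 'rV[R]_N).

Definition symmetric_mx M : Prop := M^T = M.

Definition psd M : Prop :=
  symmetric_mx M /\ forall x : 'cV[R]_N, 0 <= (x^T *m M *m x) 0 0.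

Definition frob_norm M : R := Num.sqrt (\sum_i \sum_j M i j ^+ 2).

Definition nonneg_vec d : Prop := forall i, 0 <= d 0 i.

Definition nz M : {set 'I_N * 'I_N} := [set p | M p.1 p.2 != 0].

End RealMatrices.

(* Main.v *)
Require Import Defs.
From mathcomp Require Import all_boot all_order all_algebra.
From mathcomp Require Import reals ring lra.

Set Implicit Arguments.
Unset Strict Implicit.
Unset Printing Implicit Defensive.

Import Order.TTheory GRing.Theory Num.Theory.
Local Open Scope ring_scope.

(** Let M be a completion of B, perturbed or not. Its upper left block is
    diagonal, and each column of the lower left block is nonzero exactly at the
    two endpoints of an edge, so positive semidefiniteness makes that diagonal
    positive and M is congruent to the direct sum of it and its Schur
    complement S ([schur_rank], [schur_psdP]). Hence M has rank at most m + 3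
    exactly when S has rank at most 3. The subtracted matrix
    K D^-1 K^T changes off-diagonal entries of A only at nonedges of the
    supergraph: S vanishes at the edges and keeps the entries between copies of
    one vertex, while at a nonedge it can be given any value below 2.

    If the graph is 3-colourable, so is the supergraph ([extend_coloring]), and
    the same-colour indicator matrix, which is the Gram matrix of the basis
    vectors of R^3 selected by the colours, has the required pattern. Its
    entries are below 2, so D > 0 realizing it exists ([colored_completion]).

    Conversely, S is the Gram matrix of vectors in a space of dimension at most
    3. The support condition on H keeps the zeros of S at edges exact, and
    |H| <= 1/2 keeps the entries between copies, which are 1 for H = 0, away
    from 0; so every vertex gets a nonzero vector, and adjacent vertices get
    orthogonal ones ([perturbed_schur]). In dimension 3 a gadget forces the
    vectors of i and j to be orthogonal or parallel
    ([gadget_orthogonal_or_multiple]). Non-orthogonality is then an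
    equivalence relation on the vertices of the original graph, with at most 3
    classes ([orthogonal_classes_coloring]), and these classes are the colours.

    Instead of extracting a Gram factorization, the argument works with the
    degenerate bilinear form x^T S y: vectors are identified modulo its
    kernel, and dimension is bounded by the rank of S. *)

(** * Orthogonality for a positive semidefinite form of rank at most 3 *)

Section Form.
Variables (R : realType) (N : nat) (S : 'M[R]_N).
Implicit Types x y z t : 'cV[R]_N.

Definition form x y : R := (x^T *m S *m y) 0 0.

(** Proportionality modulo the kernel of the form. *)
Definition multiple x y : Prop :=
  exists l : R, forall t, form x t = l * form y t.

Lemma formDl x y t : form (x + y) t = form x t + form y t.
Proof. by rewrite /form linearD /= !mulmxDl mxE. Qed.

Lemma formDr x y t : form t (x + y) = form t x + form t y.
Proof. by rewrite /form mulmxDr mxE. Qed.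

Lemma formZl a x t : form (a *: x) t = a * form x t.
Proof. by rewrite /form linearZ /= -!scalemxAl mxE. Qed.

Lemma formZr a x t : form t (a *: x) = a * form t x.
Proof. by rewrite /form -scalemxAr mxE. Qed.

Lemma form_delta u v : form (delta_mx u 0) (delta_mx v 0) = S u v.
Proof. by rewrite /form trmx_delta -rowE -colE !mxE. Qed.

(** The Gram matrix Y^T S Y of such a family is diagonal and invertible, and its
    rank is at most that of S. *)
Lemma orthogonal_family_rank k (y : 'I_k -> 'cV[R]_N) :
  (forall i j, i != j -> form (y i) (y j) = 0) ->
  (forall i, form (y i) (y i) != 0) -> (k <= \rank S)%N.
Proof.
move=> orth nz; pose Y := \matrix_(i, j) y j i 0.
have gram : Y^T *m S *m Y = diag_mx (\row_i form (y i) (y i)).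
  apply/matrixP => i j.
  have -> : (Y^T *m S *m Y) i j = form (y i) (y j).
    rewrite /form !mxE; apply: eq_bigr => a _; rewrite !mxE; congr (_ * _).
    by apply: eq_bigr => b _; rewrite !mxE.
  rewrite !mxE; have [<-|/orth -> //] := eqVneq i j.
  by rewrite mulr1n.
have gramU : Y^T *m S *m Y \in unitmx.
  rewrite gram unitmxE det_diag unitfE.
  by apply/prodf_neq0 => i _; rewrite mxE.
rewrite -(mxrank_unit gramU); apply: leq_trans (mxrankM_maxl _ _) _.
exact: mxrankM_maxr.
Qed.

Hypothesis S_psd : psd S.

Lemma formC x y : form x y = form y x.
Proof.
have -> : form x y = ((x^T *m S *m y)^T) 0 0 by rewrite [RHS]mxE.
by rewrite !trmx_mul trmxK S_psd.1 mulmxA.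
Qed.

(** If b = form x y were nonzero, the value 2 t b + form y y of the form at
    t x + y would be affine and nonconstant in t, hence negative somewhere. *)
Lemma isotropic_kernel x y : form x x = 0 -> form x y = 0.
Proof.
move=> xx0; apply/eqP/negPn/negP => xy0.
(* This t gives the value - 1. *)
pose t := - (form y y + 1) / (2 * form x y).
have := S_psd.2 (t *: x + y); rewrite -/(form _ _).
rewrite !(formDl, formDr, formZl, formZr) xx0 (formC y x).
have -> : t * (t * 0) + t * form x y + (t * form x y + form y y) = - 1.
  by rewrite /t; field.
by rewrite ler0N1.
Qed.

Lemma isotropic_diff_multiple x y l :
  form (x - l *: y) (x - l *: y) = 0 -> forall t, form x t = l * form y t.
Proof.
move=> /isotropic_kernel wt t; apply/eqP; rewrite -subr_eq0 -(wt t).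
by rewrite formDl -scaleNr formZl mulNr.
Qed.

Lemma nonorthogonal_trans x y z :
  multiple y x -> form y z != 0 -> form x z != 0.
Proof. by case=> l ->; rewrite mulf_eq0 negb_or => /andP[]. Qed.

Hypothesis S_rank : (\rank S <= 3)%N.

(** A vector orthogonal to p1 and p2 minus its projection on p3 is orthogonal to
    all three; were it not isotropic, the four vectors would force rank 4. *)
Lemma orthogonal_pair_complement p1 p2 p3 z :
  form p1 p1 != 0 -> form p2 p2 != 0 -> form p3 p3 != 0 ->
  form p1 p2 = 0 -> form p1 p3 = 0 -> form p2 p3 = 0 ->
  form z p1 = 0 -> form z p2 = 0 -> multiple z p3.
Proof.
move=> n1 n2 n3 p12 p13 p23 z1 z2; pose l := form z p3 / form p3 p3.
exists l; apply: isotropic_diff_multiple.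
set w := _ - _.
have w1 : form w p1 = 0.
  by rewrite formDl -scaleNr formZl z1 (formC p3) p13 mulr0 addr0.
have w2 : form w p2 = 0.
  by rewrite formDl -scaleNr formZl z2 (formC p3) p23 mulr0 addr0.
have w3 : form w p3 = 0.
  by rewrite formDl -scaleNr formZl mulNr divfK ?subrr.
apply/eqP/negPn/negP => nw.
suff : (4 <= \rank S)%N by rewrite leqNgt ltnS S_rank.
apply: (@orthogonal_family_rank _ (fun i : 'I_4 => nth 0 [:: p1; p2; p3; w] i)).
  case=> [[|[|[|[|?]]]] ?] [[|[|[|[|?]]]] ?] //= _;
    by rewrite ?p12 ?p13 ?p23 ?w1 ?w2 ?w3 // formC ?p12 ?p13 ?p23 ?w1 ?w2 ?w3.
by case=> [[|[|[|[|?]]]] ?].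
Qed.

Lemma multiple_orthogonal x y z :
  form x x != 0 -> multiple x y -> form x z = 0 -> form y z = 0.
Proof.
move=> nx [l xE]; move: nx; rewrite !xE mulf_eq0 negb_or => /andP[l0 _] /eqP.
by rewrite mulf_eq0 (negPf l0) => /eqP.
Qed.

(** Suppose that j is not parallel to i and let w be its component orthogonal
    to i. Then i, w, a are orthogonal axes of the 3-dimensional space. Now d is
    orthogonal to i and w, so it lies on the axis a; b is orthogonal to i and a,
    so it lies on the axis w; and c is orthogonal to both b and d, so it lies on
    the axis i. Since c is orthogonal to j, so is i. *)
Lemma gadget_orthogonal_or_multiple i j a b c d :
  form i i != 0 -> form a a != 0 -> form b b != 0 -> form c c != 0 ->
  form d d != 0 ->
  form i a = 0 -> form i b = 0 -> form a b = 0 ->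
  form j c = 0 -> form j d = 0 -> form c d = 0 ->
  form a j = 0 -> form i d = 0 -> form b c = 0 ->
  form i j = 0 \/ multiple j i.
Proof.
move=> ni na nb nc nd ia ib ab jc jd cd aj id bc.
pose l := form j i / form i i; pose w := j - l *: i.
have iw : form i w = 0.
  by rewrite formC formDl -scaleNr formZl mulNr divfK ?subrr.
have aw : form a w = 0.
  by rewrite formDr -scaleNr formZr aj (formC a i) ia mulr0 addr0.
have dw : form d w = 0.
  by rewrite formDr -scaleNr formZr (formC d j) jd (formC d i) id mulr0 addr0.
have [w0|nw] := eqVneq (form w w) 0.
  by right; exists l; apply: isotropic_diff_multiple.
left.
have da : multiple d a.
  by apply: (@orthogonal_pair_complement i w); rewrite // formC.
have bw : multiple b w.
  by apply: (@orthogonal_pair_complement i a); rewrite // formC.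
have wc := multiple_orthogonal nb bw bc.
have ac : form a c = 0 by apply: (multiple_orthogonal nd da); rewrite formC.
have ci : multiple c i.
  by apply: (@orthogonal_pair_complement w a); rewrite // formC.
by apply: (multiple_orthogonal nc ci); rewrite formC.
Qed.

(** A maximal set of pairwise orthogonal vectors has at most 3 members, and by
    maximality every vector is non-orthogonal, hence parallel, to one of them:
    that member is its colour. *)
Lemma orthogonal_classes_coloring (T : finType) (x : T -> 'cV[R]_N) :
  (forall i, form (x i) (x i) != 0) ->
  (forall i j, i != j -> form (x i) (x j) = 0 \/ multiple (x j) (x i)) ->
  exists c : T -> 'I_3, forall i j, c i = c j -> form (x i) (x j) != 0.
Proof.
move=> nx dich.
pose P (C : {set T}) := [forall i in C, forall j in C,
  (i != j) ==> (form (x i) (x j) == 0)].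
have PP (C : {set T}) :
    reflect {in C &, forall i j, i != j -> form (x i) (x j) = 0} (P C).
  apply: (iffP forall_inP) => [H i j iC jC ij | H i iC].
    by have /forall_inP/(_ j jC)/implyP/(_ ij)/eqP := H i iC.
  by apply/forall_inP => j jC; apply/implyP => ij; rewrite H.
have [C /maxsetP[/PP Corth Cmax] _] : {C | maxset P C & set0 \subset C}.
  by apply: maxset_exists; apply/PP => i j; rewrite inE.
have C3 : (#|C| <= 3)%N.
  apply: leq_trans S_rank.
  apply: (@orthogonal_family_rank _ (fun k : 'I_#|C| => x (enum_val k))) => // i j ij.
  by apply: Corth; rewrite ?enum_valP // (inj_eq enum_val_inj).
have cover i : exists k : 'I_#|C|, form (x i) (x (enum_val k)) != 0.
  have [iC|iC] := boolP (i \in C).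
    by exists (enum_rank_in iC i); rewrite enum_rankK_in.
  have /forallPn[k nk] : ~~ [forall k : 'I_#|C|, form (x i) (x (enum_val k)) == 0].
    apply: contra iC => /forallP orth.
    have orthC j : j \in C -> form (x i) (x j) = 0.
      by move=> jC; have := orth (enum_rank_in jC j); rewrite enum_rankK_in // => /eqP.
    rewrite -(Cmax (i |: C)) ?subsetUr ?setU11 //; apply/PP => a b.
    rewrite !inE => /predU1P[->|aC] /predU1P[->|bC] ab.
    - by rewrite eqxx in ab.
    - exact: orthC.
    - by rewrite formC orthC.
    - exact: Corth.
  by exists k.
exists (fun i => widen_ord C3 (xchoose (cover i))) => i j /(congr1 val) /= kk.
have {}kk : xchoose (cover i) = xchoose (cover j) by apply: val_inj.
have := xchooseP (cover i); have := xchooseP (cover j); rewrite -kk.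
set y := x _; move: (enum_val _) @y => k y jy iy.
have [->//|ij] := eqVneq i j.
have [ik|] := eqVneq i k; first by rewrite ik formC.
move=> /dich[E|ym]; first by rewrite /y E eqxx in iy.
by apply: nonorthogonal_trans ym _; rewrite formC.
Qed.

End Form.

Section SchurComplement.
Variables (R : realType) (m n : nat).
Variables (D : 'M[R]_m) (K : 'M[R]_(n, m)) (C : 'M[R]_n).

Definition schur : 'M[R]_n := C - K *m invmx D *m K^T.

Lemma psd_congr N N' (S : 'M[R]_N) (P : 'M[R]_(N', N)) :
  psd S -> psd (P *m S *m P^T).
Proof.
case=> Ssym Spos; split=> [|x].
  by rewrite /symmetric_mx !trmx_mul trmxK Ssym mulmxA.
by have := Spos (P^T *m x); rewrite trmx_mul trmxK !mulmxA.
Qed.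

Hypotheses (D_sym : D^T = D) (D_unit : D \in unitmx).

(** The unitriangular factors of block elimination, inverse to each other. *)
Let L : 'M[R]_(m + n) := block_mx 1%:M 0 (K *m invmx D) 1%:M.
Let L' : 'M[R]_(m + n) := block_mx 1%:M 0 (- (K *m invmx D)) 1%:M.

Lemma schur_congr :
  block_mx D K^T K C = L *m block_mx D 0 0 schur *m L^T.
Proof.
rewrite /L tr_block_mx !mulmx_block !trmx1 !trmx0 trmx_mul trmx_inv D_sym.
rewrite !(mul1mx, mulmx1, mul0mx, mulmx0, addr0, add0r).
by rewrite mulmxA mulmxV // mul1mx mulmxKV // mulmxA addrC subrK.
Qed.

Lemma schur_factorK : L' *m L = 1%:M.
Proof.
rewrite /L /L' mulmx_block !(mul1mx, mulmx1, mul0mx, mulmx0, addr0, add0r).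
by rewrite addNr -scalar_mx_block.
Qed.

Lemma schur_rank : \rank (block_mx D K^T K C) = (m + \rank schur)%N.
Proof.
have [_ Lu] := mulmx1_unit schur_factorK.
rewrite schur_congr mxrankMfree ?row_free_unit ?unitmx_tr //.
by rewrite eqmxMfull ?row_full_unit // rank_diag_block_mx mxrank_unit.
Qed.

Lemma schur_psdP : psd (block_mx D K^T K C) <-> psd D /\ psd schur.
Proof.
split=> [Mpsd|[[Ds Dp] [Ss Sp]]].
  have : psd (block_mx D 0 0 schur).
    have -> : block_mx D 0 0 schur = L' *m block_mx D K^T K C *m L'^T.
      rewrite schur_congr !mulmxA schur_factorK mul1mx -mulmxA -trmx_mul schur_factorK.
      by rewrite trmx1 mulmx1.
    exact: psd_congr.
  case; rewrite /symmetric_mx tr_block_mx !trmx0 => /eq_block_mx[Ds _ _ Ss] pos.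
  split; split=> // x.
    have := pos (col_mx x 0); rewrite tr_col_mx trmx0 mul_row_block.
    by rewrite !(mul0mx, mulmx0, addr0) mul_row_col mulmx0 addr0.
  have := pos (col_mx 0 x); rewrite tr_col_mx trmx0 mul_row_block.
  by rewrite !(mul0mx, mulmx0, add0r) mul_row_col mulmx0 add0r.
rewrite schur_congr; apply: psd_congr; split=> [|x].
  by rewrite /symmetric_mx tr_block_mx !trmx0 Ds Ss.
rewrite -(vsubmxK x) tr_col_mx mul_row_block !(mulmx0, addr0, add0r).
by rewrite mul_row_col mxE addr_ge0.
Qed.

End SchurComplement.

(** * The entries of the Schur complement of the input matrix *)

Lemma invmx_diag (R : realType) N (d : 'rV[R]_N) :
  (forall i, d 0 i != 0) ->
  diag_mx d \in unitmx /\ invmx (diag_mx d) = diag_mx (map_mx GRing.inv d).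
Proof.
move=> nz.
have dV : diag_mx d *m diag_mx (map_mx GRing.inv d) = 1%:M.
  rewrite mulmx_diag -diag_const_mx; congr diag_mx; apply/rowP => i.
  by rewrite !mxE mulfV.
have [du _] := mulmx1_unit dV; split=> //.
by rewrite -[RHS](mulKmx du) dV mulmx1.
Qed.

Lemma schur_diagE (R : realType) m n (d : 'rV[R]_m) (K : 'M[R]_(n, m)) C u v :
  (forall f, d 0 f != 0) ->
  schur (diag_mx d) K C u v = C u v - \sum_f K u f * K v f / d 0 f.
Proof.
move=> nz; rewrite /schur (invmx_diag nz).2 mul_mx_diag !mxE; congr (_ - _).
by apply: eq_bigr => f _; rewrite !mxE mulrAC.
Qed.

Section InputMatrix.
Variables (V : finType) (adj : rel V).
Hypotheses (adj_sym : symmetric adj) (adj_irr : irreflexive adj).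

Lemma nonedge_sym : symmetric (nonedge adj).
Proof. by move=> x y; rewrite /nonedge eq_sym adj_sym. Qed.

Lemma p2_edge_of_endpoints (f : {set 'I_(p2_n V)}) u v :
  f \in p2_edges adj -> u != v -> u \in f -> v \in f ->
  f = [set u; v] /\ nonedge adj (parent u) (parent v).
Proof.
case/imsetP=> -[a b]; rewrite inE /= => ab -> uv; rewrite !inE.
case/orP=> /eqP uE /orP[]/eqP vE; rewrite ?uE ?vE.
- by rewrite uE vE eqxx in uv.
- by [].
- by rewrite setUC nonedge_sym.
- by rewrite uE vE eqxx in uv.
Qed.

Lemma p2_edge_nonempty (f : 'I_(p2_m adj)) :
  exists u, u \in (enum_val f : {set 'I_(p2_n V)}).
Proof.
by have /imsetP[[a b] _ ->] := enum_valP f; exists a; rewrite !inE eqxx.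
Qed.

(** A column of K is nonzero in the two distinct rows u and v only if it is the
    column of the edge {u, v}, so off the nonedges of the given graph the Schur
    complement has the entries of the lower right block. *)
Lemma p2_overlap0 (R : realType) (K : 'M[R]_(p2_n V, p2_m adj))
    (w : 'I_(p2_m adj) -> R) u v :
  (forall u f, u \notin (enum_val f : {set 'I_(p2_n V)}) -> K u f = 0) ->
  u != v -> ~~ nonedge adj (parent u) (parent v) ->
  \sum_f K u f * K v f / w f = 0.
Proof.
move=> K0 uv nuv; apply: big1 => f _.
have [uf|/K0->] := boolP (u \in (enum_val f : {set _})); last by rewrite !mul0r.
have [vf|/K0->] := boolP (v \in (enum_val f : {set _})); last first.
  by rewrite mulr0 mul0r.
by have [_] := p2_edge_of_endpoints (enum_valP f) uv uf vf; rewrite (negPf nuv).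
Qed.

(** * From a colouring to a completion of rank m + 3 *)

Section Coloring.
Variables (R : realType) (c : V -> 'I_3).
Hypothesis c_proper : forall x y, adj x y -> c x != c y.

Let same (u v : 'I_(p2_n V)) : R := (c (parent u) == c (parent v))%:R.

(* The inverse of the diagonal entry attached to the edge f. On f = {u, v} it
   must equal 2 - same u v to turn the entry 2 of A into same u v. *)
Let weight (f : {set 'I_(p2_n V)}) : R :=
  if [forall u in f, forall v in f, c (parent u) == c (parent v)] then 1 else 2.

Lemma weight_gt0 f : 0 < weight f.
Proof. by rewrite /weight; case: ifP. Qed.

Lemma weight_pair u v : weight [set u; v] = 2 - same u v.
Proof.
rewrite /weight /same; case: eqP => [E|E].
  have -> : [forall a in [set u; v], forall b in [set u; v],
               c (parent a) == c (parent b)].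
    apply/forall_inP => a; rewrite !inE => aE.
    apply/forall_inP => b; rewrite !inE => bE.
    by case/orP: aE => /eqP ->; case/orP: bE => /eqP ->; rewrite ?E.
  by rewrite /=; ring.
rewrite ifF ?subr0 //; apply/negP => /forall_inP/(_ u); rewrite !inE eqxx.
by move=> /(_ isT)/forall_inP/(_ v); rewrite !inE eqxx orbT => /(_ isT)/eqP.
Qed.

Lemma same_psd : psd (\matrix_(u, v) same u v) /\
  (\rank (\matrix_(u, v) same u v : 'M[R]_(p2_n V)) <= 3)%N.
Proof.
pose X : 'M[R]_(p2_n V, 3) := \matrix_(u, k) (c (parent u) == k)%:R.
have -> : \matrix_(u, v) same u v = X *m 1%:M *m X^T.
  apply/matrixP => u v; rewrite mulmx1 !mxE (bigD1 (c (parent u))) //=.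
  rewrite big1 ?addr0 => [|k kc]; first by rewrite !mxE eqxx mul1r /same eq_sym.
  by rewrite !mxE eq_sym (negPf kc) mul0r.
split.
  apply: psd_congr; split=> [|x]; first exact: trmx1.
  rewrite mulmx1 !mxE; apply: sumr_ge0 => k _; rewrite mxE.
  by rewrite -expr2 sqr_ge0.
by rewrite mulmx1; apply: leq_trans (mxrankM_maxl _ _) (rank_leq_col _).
Qed.

(** The upper diagonal entries are chosen so that the off-diagonal part of the
    Schur complement is the same-colour matrix; the lower ones then correct its
    diagonal to 1. *)
Lemma colored_completion : exists d : 'rV[R]_(p2_m adj + p2_n V),
  [/\ nonneg_vec d, psd (p2_B adj R + diag_mx d) &
      (\rank (p2_B adj R + diag_mx d)%R <= p2_m adj + 3)%N].
Proof.
set K := p2_K adj R.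
pose dl : 'rV[R]_(p2_m adj) := \row_f (weight (enum_val f))^-1.
pose dr : 'rV[R]_(p2_n V) := \row_u (1 + \sum_f K u f * K u f / dl 0 f).
have dl_gt0 f : 0 < dl 0 f by rewrite mxE invr_gt0 weight_gt0.
have dl_nz f : dl 0 f != 0 by rewrite gt_eqF.
have schurE : schur (diag_mx dl) K (p2_A adj R + diag_mx dr) = \matrix_(u, v) same u v.
  apply/matrixP => u v; rewrite schur_diagE // [RHS]mxE.
  have [<-|uv] := eqVneq u v.
    rewrite !mxE eqxx /= mulr1n /nonedge eqxx /= adj_irr.
    by rewrite /same eqxx add0r addrK.
  have K0 a f : a \notin (enum_val f : {set 'I_(p2_n V)}) -> K a f = 0.
    by rewrite mxE => /negPf ->.
  rewrite !mxE (negPf uv) mulr0n addr0.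
  case: ifPn => [nuv|nuv]; last first.
    rewrite (p2_overlap0 _ K0 uv nuv) subr0 /same.
    case: ifPn => [/c_proper/negPf ->//|auv].
    move: nuv; rewrite /nonedge auv andbT negbK => /eqP ->.
    by rewrite eqxx.
  have fE : [set u; v] \in p2_edges adj.
    by apply/imsetP; exists (u, v); rewrite ?inE.
  rewrite (bigD1 (enum_rank_in fE [set u; v])) //= big1 ?addr0; last first.
    move=> f nf.
    have [uf|/K0->] := boolP (u \in (enum_val f : {set _})); last by rewrite !mul0r.
    have [vf|/K0->] := boolP (v \in (enum_val f : {set _})); last first.
      by rewrite mulr0 mul0r.
    have [E _] := p2_edge_of_endpoints (enum_valP f) uv uf vf.
    by case/eqP: nf; apply: enum_val_inj; rewrite enum_rankK_in.
  rewrite !mxE enum_rankK_in // !inE !eqxx orbT invrK !mul1r weight_pair.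
  by ring.
have BE : p2_B adj R + diag_mx (row_mx dl dr) =
    block_mx (diag_mx dl) K^T K (p2_A adj R + diag_mx dr).
  by rewrite diag_mx_row add_block_mx add0r !addr0.
have [dlu _] := invmx_diag dl_nz.
have [Spsd Srk] := same_psd.
exists (row_mx dl dr); split.
- move=> i; rewrite mxE; case: split_ordP => k _; first exact: ltW.
  rewrite mxE addr_ge0 ?ler01 //; apply: sumr_ge0 => f _.
  by rewrite -expr2 divr_ge0 ?sqr_ge0 // ltW.
- rewrite BE; apply/schur_psdP; rewrite ?tr_diag_mx ?schurE //; split=> //.
  split=> [|x]; first exact: tr_diag_mx.
  rewrite mul_mx_diag mxE; apply: sumr_ge0 => f _; rewrite !mxE mulrAC.
  by rewrite mulr_ge0 -?expr2 ?sqr_ge0 // invr_ge0 ltW ?weight_gt0.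
- by rewrite BE schur_rank ?tr_diag_mx // schurE leq_add2l.
Qed.

End Coloring.

(** * From a perturbed completion to a form on the vertices *)

Lemma entry_le_frob (R : realType) N (H : 'M[R]_N) i j : `|H i j| <= frob_norm H.
Proof.
rewrite /frob_norm -sqrtr_sqr ler_wsqrtr // (bigD1 i) //= (bigD1 j) //= -addrA.
rewrite lerDl addr_ge0 ?sumr_ge0 // => k _; first exact: sqr_ge0.
by apply: sumr_ge0 => l _; exact: sqr_ge0.
Qed.

(** The bound 1/2 serves only to keep the perturbed entries 1 of K and of A away
    from 0; the support condition keeps their zeros exact. *)
Lemma perturbed_schur (R : realType) (d : 'rV[R]_(p2_m adj + p2_n V))
    (H : 'M[R]_(p2_m adj + p2_n V)) :
  frob_norm H <= 2^-1 -> psd (p2_B adj R + diag_mx d + H) ->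
  (\rank (p2_B adj R + diag_mx d + H)%R <= p2_m adj + 3)%N ->
  nz H \subset nz (p2_B adj R) ->
  exists S : 'M[R]_(p2_n V),
    [/\ psd S, (\rank S <= 3)%N,
        forall u v, adj (parent u) (parent v) -> S u v = 0 &
        forall u v, u != v -> parent u = parent v -> S u v != 0].
Proof.
move=> Hsmall; set M := _ + H => Mpsd Mrank Hnz.
have Hsub i j : p2_B adj R i j = 0 -> H i j = 0.
  move=> B0; apply/eqP/negPn/negP => h.
  by have := subsetP Hnz (i, j); rewrite !inE /= h B0 eqxx => /(_ isT).
have Hle i j : `|H i j| <= 2^-1 := le_trans (entry_le_frob H i j) Hsmall.
pose dl := lsubmx d; pose dr := rsubmx d.
pose K := p2_K adj R + dlsubmx H.
pose C := p2_A adj R + diag_mx dr + drsubmx H.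
have Kout u f : u \notin (enum_val f : {set 'I_(p2_n V)}) -> K u f = 0.
  move=> uf; have k0 : p2_K adj R u f = 0 by rewrite mxE (negPf uf).
  rewrite mxE k0 add0r !mxE; apply: Hsub.
  by rewrite /p2_B block_mxEdl.
have Kin u f : u \in (enum_val f : {set 'I_(p2_n V)}) -> K u f != 0.
  move=> uf; rewrite !mxE uf mulr1n; apply/eqP => h0.
  by have := Hle (rshift (p2_m adj) u) (lshift (p2_n V) f); rewrite ler_norml; lra.
have ME : M = block_mx (diag_mx dl) K^T K C.
  have [Msym _] := Mpsd.
  have dE : diag_mx d = block_mx (diag_mx dl) 0 0 (diag_mx dr).
    by rewrite -diag_mx_row hsubmxK.
  have dlE : dlsubmx M = K.
    by rewrite /M dE -[H in LHS]submxK !add_block_mx block_mxKdl addr0.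
  rewrite -(submxK M) dlE; congr block_mx.
  - rewrite /M dE -[H in LHS]submxK !add_block_mx block_mxKul add0r.
    have -> : ulsubmx H = 0; last by rewrite addr0.
    by apply/matrixP => i j; rewrite !mxE; apply: Hsub; rewrite block_mxEul mxE.
  - by rewrite -dlE trmx_dlsub Msym.
  - by rewrite /M dE -[H in LHS]submxK !add_block_mx block_mxKdr.
(* A zero diagonal entry would force the nonzero column K _ f to vanish. *)
have dl_nz f : dl 0 f != 0.
  apply/eqP => f0; have [u uf] := p2_edge_nonempty f.
  pose ef : 'cV[R]_(p2_m adj + p2_n V) := delta_mx (lshift _ f) 0.
  have ef0 : form M ef ef = 0.
    by rewrite form_delta ME block_mxEul mxE f0 mul0rn.
  have := isotropic_kernel Mpsd (delta_mx (rshift _ u) 0) ef0.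
  rewrite form_delta ME block_mxEur mxE => /eqP.
  by rewrite (negPf (Kin u f uf)).
have [dlu _] := invmx_diag dl_nz.
exists (schur (diag_mx dl) K C); split.
- by move: Mpsd; rewrite ME => /schur_psdP[]; rewrite ?tr_diag_mx.
- by move: Mrank; rewrite ME schur_rank ?tr_diag_mx // leq_add2l.
- move=> u v auv.
  have uv : u != v by apply: contraTneq auv => ->; rewrite adj_irr.
  have nuv : ~~ nonedge adj (parent u) (parent v) by rewrite /nonedge auv andbF.
  have A0 : p2_A adj R u v = 0 by rewrite mxE (negPf nuv) auv.
  rewrite schur_diagE // (p2_overlap0 _ Kout uv nuv) subr0 mxE mxE A0 !mxE.
  rewrite (negPf uv) mulr0n !add0r; apply: Hsub.
  by rewrite /p2_B block_mxEdr.
- move=> u v uv puv.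
  have nuv : ~~ nonedge adj (parent u) (parent v) by rewrite /nonedge puv eqxx.
  rewrite schur_diagE // (p2_overlap0 _ Kout uv nuv) subr0 !mxE (negPf nuv).
  rewrite puv adj_irr (negPf uv) mulr0n addr0; apply/eqP => h0.
  by have := Hle (rshift (p2_m adj) u) (rshift (p2_m adj) v); rewrite ler_norml; lra.
Qed.

End InputMatrix.

(** * The supergraph *)

Section Supergraph.
Variables (T : finType) (e o : rel T).

Lemma padj_sym : symmetric e -> symmetric (padj e o).
Proof.
move=> es x y; rewrite /padj; congr (_ || _).
  by case: x y => [x|x] [y|y].
by apply: eq_existsb => p; rewrite orbC.
Qed.

Lemma padj_irr : irreflexive e -> irreflexive o -> irreflexive (padj e o).
Proof.
move=> ei oi x; rewrite /padj; apply/norP; split.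
  by case: x => // x; rewrite ei.
apply/existsP => -[p]; rewrite orbb !inE.
by do 8 (case/predU1P=> [[-> //]|]); case/eqP=> ->.
Qed.

Lemma padj_gadget (p : listed_pair o) (x y : pvertex o) :
  (x, y) \in gadget_edges p -> padj e o x y.
Proof. by move=> xy; apply/orP; right; apply/existsP; exists p; rewrite xy. Qed.

(** A proper colouring of a gadget whose terminals have colours x and y, equal or
    not. When x and y differ, - (x + y) in Z/3 is the third colour. *)
Definition gadget_color (x y : 'I_3) (l : gadget_label) : 'I_3 :=
  if x == y then match l with La | Lc => x + 1 | Lb | Ld => x + 2 end
  else match l with La | Ld => - (x + y) | Lb => y | Lc => x end.

Lemma extend_coloring :
  three_colorable e -> three_colorable (padj e o).
Proof.
case=> c cP.
pose c' (x : pvertex o) := match x with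
  | inl i => c i
  | inr (p, l) => gadget_color (c (val p).1) (c (val p).2) l end.
have gP p x y : (x, y) \in gadget_edges p -> c' x != c' y.
  suff /allP H : all (fun z => c' z.1 != c' z.2) (gadget_edges p) by move/H.
  rewrite /=; case: (c _) => [[|[|[|?]]] ?] //; by case: (c _) => [[|[|[|?]]] ?].
exists c' => x y /orP[|/existsP[p /orP[/gP//|/gP]]]; last by rewrite eq_sym.
by case: x y => [x|?] [y|?] //; exact: cP.
Qed.

(** Every pair of original vertices is joined by a gadget, so its two vectors
    are orthogonal or parallel, and the classes of parallel vectors are colours:
    adjacent vertices are orthogonal, hence in different classes. *)
Lemma form_three_colorable (R : realType) N (S : 'M[R]_N)
    (x : pvertex o -> 'cV[R]_N) :
  pair_listing o -> irreflexive e -> psd S -> (\rank S <= 3)%N ->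
  (forall i, form S (x i) (x i) != 0) ->
  (forall i j, padj e o i j -> form S (x i) (x j) = 0) ->
  three_colorable e.
Proof.
move=> [_ oP] ei Spsd Srank nx xorth.
have gadget i j : o i j ->
    form S (x (inl i)) (x (inl j)) = 0 \/ multiple S (x (inl j)) (x (inl i)).
  move=> oij; pose p : listed_pair o := exist _ (i, j) oij.
  have E y z : (y, z) \in gadget_edges p -> form S (x y) (x z) = 0.
    by move=> /padj_gadget/xorth.
  apply: (@gadget_orthogonal_or_multiple _ _ _ Spsd Srank _ _
    (x (inr (p, La))) (x (inr (p, Lb))) (x (inr (p, Lc))) (x (inr (p, Ld))));
    by [|apply: E; rewrite !inE eqxx ?orbT].
have [|c cP] := orthogonal_classes_coloring Spsd Srank
  (x := fun i => x (inl i)) (fun i => nx _).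
  move=> i j ij; have := oP i j ij; case: (boolP (o j i)) => [/gadget oji _|_ /gadget //].
  case: oji => [|[l lE]]; first by rewrite formC //; left.
  right.
  have l0 : l != 0.
    by apply: contraNneq (nx (inl i)) => l0; rewrite lE l0 mul0r.
  by exists l^-1 => t; rewrite lE mulrA mulVf // mul1r.
exists c => i j eij; apply/eqP => /cP; rewrite xorth ?eqxx //.
by rewrite /padj eij.
Qed.

End Supergraph.

Theorem theorem3p12 (R : realType) :
  exists eps0 : R, 0 < eps0 /\
  forall (T : finType) (e : rel T) (o : rel T),
    symmetric e -> irreflexive e -> pair_listing o ->
    let G' := padj e o in
    let n := p2_n (pvertex o) in
    let m := p2_m G' in
    let B : 'M[R]_(m + n) := p2_B G' R in
    (three_colorable e ->
       exists d : 'rV[R]_(m + n),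
         [/\ nonneg_vec d,
             psd (B + diag_mx d)
           & (\rank (B + diag_mx d)%R <= m + 3)%N])
    /\
    ((exists (d : 'rV[R]_(m + n)) (H : 'M[R]_(m + n)),
        nonneg_vec d /\ symmetric_mx H /\
        frob_norm H <= eps0 /\
        psd (B + diag_mx d + H) /\
        (\rank (B + diag_mx d + H)%R <= m + 3)%N /\
        nz H \subset nz B) ->
     three_colorable e).
Proof.
exists 2^-1; split=> [|T e o es ei op /=]; first by rewrite invr_gt0.
have G'sym := @padj_sym _ _ o es; have G'irr := padj_irr ei op.1.
split=> [/(@extend_coloring _ _ o)[c cP]|]; first exact: colored_completion cP.
move=> [d [H [_ [_ [Hsmall [Mpsd [Mrank Hnz]]]]]]].
have [S [Spsd Srank Sedge Scopy]] :=
  perturbed_schur G'sym G'irr Hsmall Mpsd Mrank Hnz.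
pose copy (v : pvertex o) k : 'I_(p2_n (pvertex o)) := enum_rank (v, k).
have copyK v k : parent (copy v k) = v by rewrite /parent enum_rankK.
apply: (form_three_colorable (S := S) (x := fun v => delta_mx (copy v ord0) 0)
  op ei Spsd Srank) => [v|v w vw]; rewrite ?form_delta; last first.
  by apply: Sedge; rewrite !copyK.
(* An isotropic vector would be orthogonal to the vector of another copy of the
   same vertex. *)
apply/eqP => v0.
have := isotropic_kernel Spsd (delta_mx (copy v ord_max) 0)
  (etrans (form_delta S (copy v ord0) (copy v ord0)) v0).
rewrite form_delta; apply/eqP/Scopy; rewrite ?copyK //.
by rewrite (inj_eq enum_rank_inj) xpair_eqE eqxx.
Qed.
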